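(* Let $\Sigma,\Gamma$ be finite alphabets, each with at least two letters. For every infinite word $w\in\Sigma^{\mathbb{N}}$, $$\mathrm{ACE}_{\mathcal{I}}(w) \le (|\Sigma|+1) + |\Sigma|(|\Sigma|+1)\big(\lfloor \mathrm{ACE}(w)\rfloor + 1\big).$$
   Context: $\mathrm{Fact}_n(w)$ is the set of length-$n$ factors of $w$. For a nonempty word $v$ and integer $p\ge0$, $v^{p/|v|}$ is the prefix of length $p$ of $vvv\cdots$. For a nonempty finite word $u$, $\mathrm{E}(u) = \sup\{ r \in \mathbb{Q} : u = v^r \text{ for some nonempty } v\}$. For an infinite word $w$, $\mathrm{ACE}(w) = \limsup_{n\to\infty}\sup\{\mathrm{E}(u) : u\in\mathrm{Fact}_n(w)\}$. $\mathcal{I}$ is the set of injective morphisms $\Sigma^*\to\Gamma^*$ and $\mathrm{ACE}_{\mathcal{I}}(w) = \sup\{\mathrm{ACE}(h(w)) : h\in\mathcal{I}\}$. (If $\mathrm{ACE}(w)=\infty$ the right-hand side is $\infty$.) *)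

(* Defs.v *)
From HB Require Import structures.
From mathcomp Require Import all_boot all_order all_algebra.
From mathcomp Require Import all_classical all_reals.
From mathcomp Require Import ereal topology normedtype sequences.
Set Implicit Arguments. Unset Strict Implicit. Unset Printing Implicit Defensive.
Import Order.TTheory GRing.Theory Num.Theory.
Local Open Scope classical_set_scope.
Local Open Scope ring_scope.
Local Open Scope ereal_scope.

Definition pref (A : Type) (w : nat -> A) (m : nat) : seq A := mkseq w m.

(* v^{p/|v|} : the prefix of length p of v v v ... (v nonempty) *)
Definition vpow (A : Type) (v : seq A) (p : nat) : seq A :=
  take p (flatten (nseq p v)).

(* E(u) = sup { r in Q : u = v^r, v nonempty }.  v^r is only defined when
   r |v| is a natural number p, i.e. r = p/|v|. *)
Definition Eexp (R : realType) (A : eqType) (u : seq A) : \bar R :=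
  ereal_sup [set ((pv.1%:R / (size pv.2)%:R : R)%:E) | pv in
     [set pv : nat * seq A | pv.2 != [::] /\ u = vpow pv.2 pv.1]].

Definition Fact (A : eqType) (w : nat -> A) (n : nat) : set (seq A) :=
  [set u | size u = n /\ exists m, infix u (pref w m)].

Definition ACE_of (R : realType) (A : eqType) (F : nat -> set (seq A)) : \bar R :=
  limn_esup (fun n => ereal_sup [set Eexp R u | u in F n]).

Definition ACE (R : realType) (A : eqType) (w : nat -> A) : \bar R :=
  ACE_of R (Fact w).

(* a morphism Sigma^* -> Gamma^* is determined by the images of letters *)
Definition hstar (S G : Type) (h : S -> seq G) (u : seq S) : seq G :=
  flatten (map h u).

(* Fact_n(h(w)): the factors of the infinite word h(w) are exactly the
   factors of the images h(w_0 ... w_{m-1}) of prefixes of w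
   (h injective implies every h(a) is nonempty, so h(w) is infinite). *)
Definition Fact_img (S : Type) (G : eqType) (h : S -> seq G) (w : nat -> S) (n : nat)
  : set (seq G) :=
  [set u | size u = n /\ exists m, infix u (hstar h (pref w m))].

Definition ACE_img (R : realType) (S : Type) (G : eqType) (h : S -> seq G) (w : nat -> S)
  : \bar R := ACE_of R (Fact_img h w).

Definition ACE_I (R : realType) (S : Type) (G : eqType) (w : nat -> S) : \bar R :=
  ereal_sup [set ACE_img R h w | h in [set h : S -> seq G | injective (hstar h)]].

(* Main.v *)
Require Import Defs.
From HB Require Import structures.
From mathcomp Require Import all_boot all_order all_algebra.
From mathcomp Require Import all_classical all_reals.
From mathcomp Require Import ereal topology normedtype sequences.
From mathcomp Require Import zify.
Set Implicit Arguments. Unset Strict Implicit. Unset Printing Implicit Defensive.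

(** Let [u] be a factor of [h(w)] that is a prefix of the infinite word [f] with
    least period [p].  The least conjugate of the period is unbordered, so no
    square of period shorter than [p] is centred at its starting points; hence an
    occurrence of [h(a)] covering such a point has a determined phase modulo [p].
    If [u] has exponent at least [#|Sigma| * e + 3], some letter [a] covers
    [e + 1] of these points.  The factors of [w] between the corresponding
    occurrences of [a] have images that are powers of one word, so by injectivity
    they commute, and their concatenation is a power of exponent at least [e] of
    the shortest of them.  With [e = floor (ACE w) + 1] this is impossible for long
    factors, so [ACE (h(w)) <= #|Sigma| * e + 3], which is below the claimed bound.
    Small periods are handled by spacing the points by a large multiple of [p]. *)

(** * Finite windows of infinite words *)

Definition seg (A : Type) (f : nat -> A) (q d : nat) : seq A :=
  [seq f i | i <- iota q d].

Lemma size_seg (A : Type) (f : nat -> A) q d : size (seg f q d) = d.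
Proof. by rewrite size_map size_iota. Qed.

Lemma seg_cat (A : Type) (f : nat -> A) q d1 d2 :
  seg f q (d1 + d2) = seg f q d1 ++ seg f (q + d1) d2.
Proof. by rewrite /seg iotaD map_cat. Qed.

Lemma nth_seg (A : Type) (x0 : A) (f : nat -> A) q d i :
  i < d -> nth x0 (seg f q d) i = f (q + i).
Proof. by move=> id; rewrite (nth_map 0) ?size_iota // nth_iota. Qed.

Lemma eq_seg (A : Type) (f g : nat -> A) q q' d :
  (forall i, i < d -> f (q + i) = g (q' + i)) -> seg f q d = seg g q' d.
Proof.
move=> fg; apply: (@eq_from_nth _ (f 0)); rewrite !size_seg // => i id.
by rewrite !nth_seg // fg.
Qed.

Lemma seg_inj (A : Type) (f g : nat -> A) q q' d i :
  seg f q d = seg g q' d -> i < d -> f (q + i) = g (q' + i).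
Proof.
by move=> fg id; rewrite -(nth_seg (f 0) f q id) fg nth_seg.
Qed.

(** * Unbordered conjugates *)

Section WordValue.
Variable G : finType.
Implicit Types s t : seq G.

(** The value of [s] in base [#|G|]: an injective numbering of the words of a given length,
    compatible with concatenation, which stands in for the lexicographic order. *)
Definition wval s : nat := foldl (fun n a => n * #|G| + enum_rank a) 0 s.

Lemma wval_rcons s a : wval (rcons s a) = wval s * #|G| + enum_rank a.
Proof. by rewrite /wval foldl_rcons. Qed.

Lemma wval_cat s t : wval (s ++ t) = wval s * #|G| ^ size t + wval t.
Proof.
elim/last_ind: t => [|t a IH]; first by rewrite cats0 expn0 muln1 addn0.
rewrite -rcons_cat !wval_rcons IH size_rcons expnSr mulnDl -!mulnA.
by rewrite !addnA.
Qed.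

Lemma wval_inj s t : size s = size t -> wval s = wval t -> s = t.
Proof.
elim/last_ind: s t => [|s a IH] t; first by case: t.
case/lastP: t => [|t b]; rewrite ?size_rcons // => -[sz].
rewrite !wval_rcons => E.
have rk (c : G) : enum_rank c < #|G| := ltn_ord _.
have G0 : 0 < #|G| by apply: leq_trans (rk a).
have Ev : wval s = wval t.
  by have := congr1 (divn^~ #|G|) E; rewrite !divnMDl // !divn_small ?addn0.
rewrite (IH t) //; congr (rcons _ _).
by apply/enum_rank_inj/val_inj => /=; move: E; rewrite Ev => /addnI.
Qed.

End WordValue.

Lemma periodic_mul (A : Type) (f : nat -> A) p i t :
  (forall i, f (i + p) = f i) -> f (i + t * p) = f i.
Proof.
by move=> fp; elim: t => [|t IH]; rewrite ?addn0 // mulSnr addnA fp.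
Qed.

Lemma periodic_modn (A : Type) (f : nat -> A) p i j :
  (forall i, f (i + p) = f i) -> i = j %[mod p] -> f i = f j.
Proof.
move=> fp ij; rewrite (divn_eq i p) (divn_eq j p) ij.
by rewrite ![_ * p + _]addnC !periodic_mul.
Qed.

Definition minimal_period (A : Type) (f : nat -> A) (p : nat) : Prop :=
  [/\ 0 < p, forall i, f (i + p) = f i &
     forall d, 0 < d < p -> ~ (forall i, f (i + d) = f i)].

Lemma minimal_period_exists (A : Type) (f : nat -> A) p0 :
  0 < p0 -> (forall i, f (i + p0) = f i) ->
  exists2 p, p <= p0 & minimal_period f p.
Proof.
move=> p00 fp0.
pose P p := (0 < p) && `[< forall i, f (i + p) = f i >].
have exP : exists p, P p by exists p0; apply/andP; split => //; apply/asboolP.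
case: (ex_minnP exP) => p /andP[p_gt0 /asboolP fp] pmin; exists p.
  by apply: pmin; apply/andP; split => //; apply/asboolP.
split => // d /andP[d0 dp] fd.
by have := pmin d; rewrite /P d0 leqNgt dp => /(_ (asboolT fd)).
Qed.

(* Start at the least conjugate [x y = z x]: comparing it with the conjugates
   [x z] and [y x] forces [y = z], so a border would yield the period [|x|]. *)
Lemma unbordered_point (G : finType) (f : nat -> G) p : minimal_period f p ->
  exists2 c, c < p & forall c' d, c' = c %[mod p] -> p <= c' -> 0 < d < p ->
    ~ (forall i, i < d -> f (c' - d + i) = f (c' + i)).
Proof.
move=> [p0 fp pmin].
pose V c := wval (seg f c p).
have exV : exists n, [exists c : 'I_p, V c == n].
  by exists (V 0); apply/existsP; exists (Ordinal p0).
case: (ex_minnP exV) => n /existsP[c /eqP Vc] nmin.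
have segm i j d : i = j %[mod p] -> seg f i d = seg f j d.
  move=> ij; apply: eq_seg => t _; apply: (periodic_modn fp).
  by rewrite -modnDml ij modnDml.
have Vmin i : n <= V i.
  apply: nmin; apply/existsP; exists (Ordinal (ltn_pmod i p0)) => /=.
  by rewrite /V (@segm (i %% p) i) ?modn_mod.
exists (val c); first exact: ltn_ord.
move=> c' d c'c pc' /andP[d0 dp] rep.
have Vc' : V c' = n by rewrite -Vc /V (segm _ _ p c'c).
pose x := seg f c' d; pose y := seg f (c' + d) (p - d); pose z := seg f c' (p - d).
have xE : seg f (c' - d) d = x by apply: eq_seg.
have Exy : seg f c' p = x ++ y by rewrite -seg_cat subnKC // ltnW.
have Ezx : seg f c' p = z ++ x.
  rewrite -{1}(subnK (ltnW dp)) seg_cat -xE; congr (_ ++ _); apply: segm.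
  by rewrite -[in RHS](modnDr (c' - d) p); congr (_ %% _); lia.
have Exz : seg f (c' - d) p = x ++ z.
  by rewrite -{1}(subnKC (ltnW dp)) seg_cat xE subnK //; lia.
have Eyx : seg f (c' + d) p = y ++ x.
  rewrite -{1}(subnK (ltnW dp)) seg_cat; congr (_ ++ _); apply: segm.
  by rewrite -[in RHS](modnDr c' p); congr (_ %% _); lia.
have yz : y = z.
  have szyz : size y = size z by rewrite !size_seg.
  (* Minimality of the value at [c'] gives [x y <= x z] and [z x <= y x]; cancelling [x] leaves
     [y <= z <= y]. *)
  have le1 := Vmin (c' - d); have le2 := Vmin (c' + d).
  apply: wval_inj => //; apply/eqP; rewrite eqn_leq; apply/andP; split.
    by move: le1; rewrite -Vc' /V Exz Exy !wval_cat szyz leq_add2l.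
  move: le2; rewrite -Vc' /V Eyx Ezx !wval_cat leq_add2r leq_pmul2r //.
  by rewrite expn_gt0; apply/orP; left; apply/card_gt0P; exists (f 0).
apply: (pmin d); first by rewrite d0.
have Ed : seg f (c' + d) p = seg f c' p by rewrite Eyx yz -Ezx.
(* Adding [c' * p] moves [i] beyond [c']; reducing [t] modulo [p] then lands inside the two windows
   compared by [Ed]. *)
move=> i; pose t := i + c' * p - c'.
have ct : c' + t = i + c' * p by rewrite /t; nia.
have -> : f i = f (c' + t %% p).
  apply: (periodic_modn fp); rewrite modnDmr ct.
  by rewrite addnC modnMDl.
rewrite -(seg_inj Ed) ?ltn_pmod //; apply: (periodic_modn fp).
by rewrite modnDmr addnAC ct addnAC [in RHS]addnC modnMDl.
Qed.

(* Two occurrences of a word covering an unbordered point with different phases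
   would create a short square centred at that point. *)
Lemma same_phase (A : Type) (f : nat -> A) p c b1 b2 c1 c2 L :
  0 < p -> (forall i, f (i + p) = f i) ->
  (forall c' d, c' = c %[mod p] -> p <= c' -> 0 < d < p ->
    ~ (forall i, i < d -> f (c' - d + i) = f (c' + i))) ->
  c1 = c %[mod p] -> c2 = c %[mod p] -> p <= c1 -> p <= c2 ->
  b1 <= c1 < b1 + L -> b2 <= c2 < b2 + L ->
  seg f b1 L = seg f b2 L -> b1 = b2 %[mod p].
Proof.
move=> p0 fp crit.
wlog le12 : b1 b2 c1 c2 / c1 - b1 <= c2 - b2 => [W|].
  case: (leqP (c1 - b1) (c2 - b2)) => [|/ltnW] le; first exact: W le.
  by move=> *; apply/esym; apply: (W b2 b1 c2 c1).
move=> cc1 cc2 pc1 pc2 /andP[bc1 cb1] /andP[bc2 cb2] Es.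
(* [D] is the difference between the offsets of the two points inside the common word, so the phases
   agree exactly when [p] divides it. Otherwise [d] is half the length of a forbidden square. *)
pose D := c2 - b2 - (c1 - b1); pose d := D %% p.
case: (posnP d) => [d0|dpos].
  have : c1 - b1 + b1 = (c1 - b1) + D + b2 %[mod p].
    rewrite subnK // cc1 -cc2; congr (_ %% _); rewrite /D; lia.
  rewrite -addnA => /eqP; rewrite eqn_modDl => /eqP ->.
  by rewrite -modnDml -/d d0 add0n.
case: (crit c2 d) => //; first by rewrite dpos ltn_pmod.
move=> i id; have dD : d <= D := leq_mod _ _.
have iL : c2 - b2 - d + i < L by lia.
have -> : c2 - d + i = b2 + (c2 - b2 - d + i) by move: dD; rewrite /D; lia.
(* Read the letter in the first occurrence instead: there it lies a multiple of [p] beyond [c1 + i],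
   in phase with [c2 + i]. *)
rewrite -(seg_inj Es iL).
have -> : b1 + (c2 - b2 - d + i) = c1 + i + D %/ p * p.
  by move: dD; have := divn_eq D p; rewrite -/d /D; lia.
rewrite periodic_mul //; apply: (periodic_modn fp).
by rewrite -modnDml cc1 -cc2 modnDml.
Qed.

(** * Powers and morphic images *)

Lemma size_flatten_nseq (A : Type) n (x : seq A) :
  size (flatten (nseq n x)) = n * size x.
Proof. by rewrite size_flatten /shape map_nseq sumn_nseq mulnC. Qed.

Lemma size_vpow (A : eqType) (v : seq A) p : v != [::] -> size (vpow v p) = p.
Proof.
rewrite -size_eq0 -lt0n => v0.
by rewrite size_takel // size_flatten_nseq leq_pmulr.
Qed.

Lemma nth_flatten_nseq (A : Type) (x0 : A) n (v : seq A) i :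
  i < n * size v -> nth x0 (flatten (nseq n v)) i = nth x0 v (i %% size v).
Proof.
elim: n i => [|n IH] i //= ilt.
rewrite nth_cat; case: ltnP => iv; first by rewrite modn_small.
rewrite IH; last by move: ilt; rewrite mulSn; lia.
by congr (nth _ _ _); rewrite -[in RHS](subnK iv) modnDr.
Qed.

Lemma nth_vpow (A : eqType) (x0 : A) (v : seq A) p i :
  v != [::] -> i < p -> nth x0 (vpow v p) i = nth x0 v (i %% size v).
Proof.
rewrite -size_eq0 -lt0n => v0 ip; rewrite nth_take // nth_flatten_nseq //.
by apply: leq_trans ip _; rewrite leq_pmulr.
Qed.

(** [X] commutes with every power of [x], so [X] and such a power are prefixes of one word; the
    power [size X] is at least as long as [X]. *)
Lemma commute_vpow (A : eqType) (X x : seq A) :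
  x != [::] -> X ++ x = x ++ X -> X = vpow x (size X).
Proof.
rewrite -size_eq0 -lt0n => x0 com.
have comn n : flatten (nseq n x) ++ X = X ++ flatten (nseq n x).
  elim: n => [|n IH]; rewrite ?cats0 //= -catA IH !catA; congr (_ ++ _).
  exact/esym.
rewrite /vpow -(takel_cat X); last by rewrite size_flatten_nseq leq_pmulr.
by rewrite comn take_size_cat.
Qed.

Lemma hstar_cat (S G : Type) (h : S -> seq G) s t :
  hstar h (s ++ t) = hstar h s ++ hstar h t.
Proof. by rewrite /hstar map_cat flatten_cat. Qed.

Lemma hstar_inj_letter (S G : eqType) (h : S -> seq G) a :
  injective (hstar h) -> 0 < size (h a).
Proof.
move=> hi; rewrite lt0n size_eq0; apply/eqP => ha.
by have /hi : hstar h [:: a] = hstar h [::] by rewrite /hstar /= ha.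
Qed.

Lemma pref_seg (A : Type) (w : nat -> A) m : pref w m = seg w 0 m.
Proof. by []. Qed.

Section Image.
Variables (S G : eqType) (h : S -> seq G) (w : nat -> S) (g0 : G).
Hypothesis h_inj : injective (hstar h).

(* [start q] is where the image of the [q]-th letter starts in the infinite word
   [h(w)], of which [imgw] lists the letters. *)
Definition start (q : nat) : nat := size (hstar h (pref w q)).
Definition imgw (i : nat) : G := nth g0 (hstar h (pref w i.+1)) i.

Lemma startD q d : start (q + d) = start q + size (hstar h (seg w q d)).
Proof. by rewrite /start !pref_seg seg_cat hstar_cat size_cat add0n. Qed.

Lemma startS q : start q.+1 = start q + size (h (w q)).
Proof. by rewrite -addn1 startD /hstar /= cats0. Qed.

Lemma start_mono q q' : q <= q' -> start q <= start q'.
Proof. by move=> /subnKC <-; rewrite startD leq_addr. Qed.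

Lemma leq_start q : q <= start q.
Proof.
elim: q => // q IH; rewrite startS.
by have := hstar_inj_letter (w q) h_inj; lia.
Qed.

Lemma start_lipschitz M q d : (forall a, size (h a) <= M) ->
  start (q + d) <= start q + d * M.
Proof.
move=> hM; elim: d => [|d IH]; first by rewrite addn0 leq_addr.
by rewrite addnS startS mulSn; have := hM (w (q + d)); move: IH; lia.
Qed.

Lemma start_locate n : exists q, start q <= n < start q.+1.
Proof.
have ex : exists q, n < start q by exists n.+1; apply: leq_start.
case: (ex_minnP ex) => -[|q] nq qmin; first by [].
exists q; rewrite nq andbT leqNgt; apply/negP => /qmin.
by rewrite ltnn.
Qed.

(** Images of prefixes of [w] are prefixes of one another, so any prefix that is long enough yields
    the same letter. *)
Lemma nth_imgw m i : i < start m -> nth g0 (hstar h (pref w m)) i = imgw i.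
Proof.
move=> im; rewrite /imgw.
have key k l : k <= l -> i < start k ->
    nth g0 (hstar h (pref w l)) i = nth g0 (hstar h (pref w k)) i.
  move=> /subnKC <- ik.
  by rewrite !pref_seg seg_cat hstar_cat nth_cat -pref_seg -/(start k) ik.
case: (leqP m i.+1) => [le|/ltnW le]; first by rewrite (key m).
by rewrite (key i.+1 m) // leq_start.
Qed.

Lemma hstar_seg q d :
  hstar h (seg w q d) = seg imgw (start q) (start (q + d) - start q).
Proof.
have sz : size (hstar h (seg w q d)) = start (q + d) - start q.
  by rewrite startD addKn.
apply: (@eq_from_nth _ g0) => [|i]; first by rewrite size_seg.
rewrite sz => id.
rewrite nth_seg // -(@nth_imgw (q + d)); last by lia.
rewrite !pref_seg seg_cat hstar_cat nth_cat -pref_seg -/(start q).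
by rewrite ltnNge leq_addr /= addKn add0n.
Qed.

Lemma Fact_img_seg n u : Fact_img h w n u -> exists P, u = seg imgw P n.
Proof.
move=> [su [m /infixP[A [B E]]]]; exists (size A).
apply: (@eq_from_nth _ g0) => [|i]; first by rewrite size_seg.
rewrite su => lt_in.
rewrite nth_seg // -(@nth_imgw m); last first.
  by rewrite /start E !size_cat su; lia.
by rewrite E nth_cat ltnNge leq_addr /= addKn nth_cat su lt_in.
Qed.

Lemma hstar_letter q : seg imgw (start q) (size (h (w q))) = h (w q).
Proof.
have := hstar_seg q 1; rewrite addn1 startS addKn => <-.
by rewrite /hstar /= cats0.
Qed.

End Image.

Lemma Fact_seg (A : eqType) (w : nat -> A) q d : Fact w d (seg w q d).
Proof.
split; first by rewrite size_seg.
exists (q + d); apply/infixP; exists (seg w 0 q), [::].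
by rewrite cats0 pref_seg seg_cat.
Qed.

(** * Pulling a high power back through the morphism *)

Lemma pigeonhole_count (T : finType) (F : nat -> T) e :
  exists a, e < count (fun j => F j == a) (iota 0 (#|T| * e).+1).
Proof.
apply/existsP; apply: contraT; rewrite negb_exists => /forallP small.
have tot : \sum_(a : T) count (fun j => F j == a) (iota 0 (#|T| * e).+1)
           = (#|T| * e).+1.
  rewrite -[RHS](size_iota 0); elim: (iota _ _) => [|j s IH] /=.
    by rewrite big1.
  rewrite big_split /= IH (bigD1 (F j)) //= eqxx big1 ?addn0 // => a.
  by rewrite eq_sym => /negbTE ->.
have : (#|T| * e).+1 <= \sum_(a : T) e.
  by rewrite -tot; apply: leq_sum => a _; rewrite leqNgt.
by rewrite sum_nat_const ltnn.
Qed.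

(** The smallest of the [e] increments is at most their average. *)
Lemma short_gap (Q : nat -> nat) e : 0 < e ->
  (forall i, i < e -> Q i <= Q i.+1) ->
  exists2 i, i < e & (Q i.+1 - Q i) * e <= Q e - Q 0.
Proof.
move=> e0 Qm.
case: (@arg_minnP _ (Ordinal e0) xpredT (fun i : 'I_e => Q i.+1 - Q i) isT).
move=> i _ imin; exists (val i); first exact: ltn_ord.
set g := Q i.+1 - Q i in imin *.
have H m : m <= e -> g * m + Q 0 <= Q m.
  elim: m => [|m IH] me; first by rewrite muln0.
  have := imin (Ordinal me) isT; have := Qm m me; have := IH (ltnW me).
  by rewrite /= mulnS; lia.
by have := H e (leqnn e); lia.
Qed.

(* [T] is a multiple of the period large enough for distinct points to be
   covered by distinct letters of [w]. *)
Lemma power_preimage (S G : finType) (h : S -> seq G) (w : nat -> S) (g0 : G)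
    M f p T P n e :
  injective (hstar h) -> (forall a, size (h a) <= M) ->
  minimal_period f p -> (forall i, i < n -> imgw h w g0 (P + i) = f i) ->
  p %| T -> 0 < T -> M <= T -> 0 < e -> (#|S| * e + 3) * T <= n ->
  exists q d x, [/\ x != [::], seg w q d = vpow x d, size x * e <= d &
                    e * T <= d.+1 * M].
Proof.
move=> h_inj hM fmin Hf pT T0 MT e0 nT.
have [p0 fp _] := fmin.
have [c cp crit] := unbordered_point fmin.
have pleT : p <= T by apply: dvdn_leq.
(* The shift [j.+1] puts every point at least [T] beyond [P]; since [M <= T], the image covering it
   starts no earlier than [P]. *)
pose C j := c + j.+1 * T.
have [q qP] := choice (fun j => start_locate w h_inj (P + C j)).
pose B := start h w.
have qM j : B (q j).+1 <= B (q j) + M by rewrite /B startS leq_add2l hM.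
have Cc j : C j = c %[mod p].
  by rewrite /C -modnDmr; case/dvdnP: pT => t ->; rewrite mulnA modnMl addn0.
have pC j : p <= C j by rewrite /C mulSn; lia.
have PB j : P <= B (q j).
  by have := qM j; case/andP: (qP j) => _; rewrite -/(B _) /C mulSn; lia.
have q_mono j j' : j < j' -> q j < q j'.
  move=> jj'; rewrite ltnNge; apply/negP => le.
  have := @start_mono _ _ h w (q j').+1 (q j).+1; rewrite ltnS => /(_ le).
  case/andP: (qP j) => + _; case/andP: (qP j') => _; have := qM j.
  have : C j + T <= C j' by rewrite /C -addnA leq_add2l -mulSnr leq_mul2r; lia.
  by rewrite -!/(B _); lia.
have [a /= ca] := pigeonhole_count (fun j => w (q j)) e.
set J := iota 0 (#|S| * e).+1 in ca.
pose js := [seq j <- J | w (q j) == a].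
have szjs : e < size js by rewrite size_filter.
have js_sorted : sorted ltn js by apply/sorted_filter/iota_ltn_sorted/ltn_trans.
pose j_ i := nth 0 js i.
have j_in i : i <= e -> j_ i <= #|S| * e /\ w (q (j_ i)) = a.
  move=> ie; have : j_ i \in js by apply/mem_nth/(leq_ltn_trans ie).
  by rewrite mem_filter mem_iota add0n ltnS => /andP[/eqP -> /andP[_ ->]].
have j_lt i i' : i < i' -> i' <= e -> j_ i < j_ i'.
  move=> ii' ie; apply: (sorted_ltn_nth ltn_trans 0 js_sorted) => //;
  by rewrite inE; lia.
have j_far i : i <= e -> j_ 0 + i <= j_ i.
  elim: i => [|i IH] ie; first by rewrite addn0.
  by have := j_lt i i.+1 (leqnn _) ie; have := IH (ltnW ie); lia.
pose Q i := q (j_ i).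
have Q_lt i i' : i < i' -> i' <= e -> Q i < Q i'.
  by move=> ii' ie; apply/q_mono/j_lt.
(* The constant 3 is spent here: one [T] for [c < p], one for the shift [j.+1], one for the image
   length [M]. *)
have Cn j : j <= #|S| * e -> C j + M <= n.
  move=> jle; apply: leq_trans nT; rewrite /C.
  have : j.+1 * T <= (#|S| * e).+1 * T by rewrite leq_mul2r ltnS jle orbT.
  by rewrite mulSn mulnDl; lia.
pose b i := B (Q i) - P.
have bE i : P + b i = B (Q i) by rewrite subnKC // PB.
have blk i : i <= e -> [/\ b i <= C (j_ i), C (j_ i) < b i + size (h a),
    b i + size (h a) <= n & seg f (b i) (size (h a)) = h a].
  move=> ie; have [jle wa] := j_in i ie.
  have := qP (j_ i); rewrite startS wa -/(B _) -/(Q i) -bE => /andP[l1 l2].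
  have bn : b i + size (h a) <= n by have := Cn _ jle; have := hM a; lia.
  split => //; first by rewrite -(leq_add2l P).
    by move: l2; rewrite -addnA ltn_add2l.
  have := hstar_letter w g0 h_inj (Q i); rewrite -/(B _) -bE.
  have -> : w (Q i) = a by []; move=> {2}<-; apply: eq_seg => t tlt.
  by rewrite -addnA Hf //; lia.
have b_mod i i' : i <= e -> i' <= e -> b i = b i' %[mod p].
  move=> ie ie'; have [l1 l2 _ E] := blk i ie; have [l1' l2' _ E'] := blk i' ie'.
  apply: (@same_phase _ f p c _ _ (C (j_ i)) (C (j_ i')) (size (h a))) => //.
  - by rewrite l1 l2.
  - by rewrite l1' l2'.
  - by rewrite E E'.
have [i ie gap] : exists2 i, i < e & (Q i.+1 - Q i) * e <= Q e - Q 0.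
  by apply: short_gap => // i ie; apply/ltnW/Q_lt.
pose word i i' := seg w (Q i) (Q i' - Q i).
have bm i1 i2 : i1 <= i2 -> i2 <= e -> b i1 <= b i2.
  rewrite leq_eqVlt => /orP[/eqP -> //|lt] le.
  by apply/leq_sub2r/start_mono/ltnW/Q_lt.
have hword i1 i2 : i1 <= i2 -> i2 <= e ->
    hstar h (word i1 i2) = seg f (b i1) (b i2 - b i1).
  move=> l12 l2; have Qle : Q i1 <= Q i2.
    by move: l12; rewrite leq_eqVlt => /orP[/eqP -> //|lt]; apply/ltnW/Q_lt.
  rewrite (hstar_seg w g0 h_inj) subnKC // -!/(B _) -!bE subnDl.
  apply: eq_seg => t tlt; rewrite -addnA Hf //.
  by have [_ _] := blk i2 l2; have := bm _ _ l12 l2; lia.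
(* All [b i] share one phase, so block lengths are multiples of [p] and the image of a concatenation
   depends only on its total length. The order of the two blocks is therefore irrelevant. *)
have catf i1 i2 i3 i4 : i1 <= i2 <= e -> i3 <= i4 <= e ->
    hstar h (word i1 i2 ++ word i3 i4)
    = seg f (b 0) (b i2 - b i1 + (b i4 - b i3)).
  move=> /andP[l12 l2] /andP[l34 l4].
  have l1 := leq_trans l12 l2; have l3 := leq_trans l34 l4.
  rewrite hstar_cat !hword // seg_cat; congr (_ ++ _); apply: eq_seg => t _;
    apply: (periodic_modn fp).
    by apply/eqP; rewrite eqn_modDr; apply/eqP/b_mod.
  apply/eqP; rewrite eqn_modDr (b_mod i3 i2) // -{1}(subnKC (bm _ _ l12 l2)).
  by rewrite eqn_modDr; apply/eqP/b_mod.
have com : word 0 e ++ word i i.+1 = word i i.+1 ++ word 0 e.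
  apply: h_inj; rewrite !catf ?leqnn ?leqnSn //=; first by rewrite addnC.
have word0 : word i i.+1 != [::].
  by rewrite -size_eq0 size_seg -lt0n subn_gt0 Q_lt.
exists (Q 0), (Q e - Q 0), (word i i.+1); split => //.
- by rewrite -/(word 0 e) (commute_vpow word0 com) size_seg.
- by rewrite size_seg.
(* The extreme points are at least [e * T] apart and are covered by the images of letters [Q 0]
   through [Q e], which are [d.+1] letters. *)
have Q0e : Q 0 < Q e by apply: Q_lt.
have : B (Q e) <= B (Q 0) + (Q e - Q 0) * M.
  by rewrite -{1}(subnKC (ltnW Q0e)); apply: start_lipschitz.
rewrite -!bE mulSn.
have [l1 _ _ _] := blk 0 (leq0n _); have [_ l2 _ _] := blk e (leqnn _).
have ha := hM a.
have : C (j_ 0) + e * T <= C (j_ e).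
  by rewrite /C -addnA leq_add2l -mulnDl leq_mul2r addSn ltnS j_far ?orbT.
lia.
Qed.

Lemma image_power_bound (S G : finType) (h : S -> seq G) (w : nat -> S) e n0 :
  injective (hstar h) -> 0 < e ->
  (forall d X x, n0 <= d -> Fact w d X -> x != [::] -> X = vpow x d ->
     d < size x * e) ->
  exists n1, forall n u v, n1 <= n -> Fact_img h w n u -> v != [::] ->
    u = vpow v n -> n <= (#|S| * e + 3) * size v.
Proof.
move=> h_inj e0 wpow.
(* With [K <= T], the inequality [e * T <= d.+1 * M] forces [n0 <= d]. *)
pose M := (\max_a size (h a)).+1; pose K := n0.+1 * M.
have hM a : size (h a) <= M by apply/leqW/(leq_bigmax (F := fun a => size (h a))).
exists ((#|S| * e + 3) * (K * K)) => n u v n1n uF v0 uv.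
rewrite leqNgt; apply/negP => nv.
have sv0 : 0 < size v by rewrite lt0n size_eq0.
have [g0 _] : exists g0, g0 \in v.
  by case: (v) v0 => // g0 v' _; exists g0; rewrite mem_head.
have [P uE] := Fact_img_seg g0 h_inj uF.
pose f i := nth g0 v (i %% size v).
have [p pv fmin] : exists2 p, p <= size v & minimal_period f p.
  by apply: minimal_period_exists => // i; rewrite /f modnDr.
have [p0 _ _] := fmin.
have Hf i : i < n -> imgw h w g0 (P + i) = f i.
  by move=> lt_in; rewrite -(nth_seg g0 _ _ lt_in) -uE uv nth_vpow.
have K0 : 0 < K by [].
have MK : M <= K by rewrite leq_pmull.
have [T [T0 KT pT nT]] : exists T, [/\ 0 < T, K <= T, p %| T &
    (#|S| * e + 3) * T <= n].
  (* A period below [K] is stretched to [p * K <= K * K], which the choice of threshold for [n]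
     accommodates. *)
  case: (leqP K p) => Kp.
    by exists p; split => //; apply: leq_trans (ltnW nv); rewrite leq_mul2l pv orbT.
  exists (p * K); split; rewrite ?muln_gt0 ?p0 ?leq_pmull ?dvdn_mulr //.
  by apply: leq_trans n1n; rewrite leq_mul2l leq_mul2r (ltnW Kp) !orbT.
have [q [d [x [x0 E gap len]]]] :=
  power_preimage h_inj hM fmin Hf pT T0 (leq_trans MK KT) e0 nT.
have n0d : n0 <= d.
  rewrite -ltnS -(leq_pmul2r (isT : 0 < M)); apply: leq_trans len.
  by apply: (leq_trans KT); rewrite leq_pmull.
by have := wpow d _ x n0d (Fact_seg w q d) x0 E; rewrite ltnNge gap.
Qed.

(** * Passage to asymptotic critical exponents *)

Import Order.TTheory GRing.Theory Num.Theory.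
Local Open Scope classical_set_scope.
Local Open Scope ring_scope.
Local Open Scope ereal_scope.

Lemma limn_esup_lt (R : realType) (u : nat -> \bar R) (x : \bar R) :
  limn_esup u < x -> exists n0, forall n, (n0 <= n)%N -> u n < x.
Proof.
move=> /ereal_inf_lt[_ [V [n0 _ n0V] <-]] Vx; exists n0 => n n0n.
apply: le_lt_trans Vx; apply: ereal_sup_ubound; exists n => //.
exact: n0V.
Qed.

Lemma limn_esup_le (R : realType) (u : nat -> \bar R) (x : \bar R) n0 :
  (forall n, (n0 <= n)%N -> u n <= x) -> limn_esup u <= x.
Proof.
move=> ux; apply: (@le_trans _ _ (ereal_sup (u @` [set n | (n0 <= n)%N]))).
  apply: ereal_inf_lbound; exists [set n | (n0 <= n)%N] => //.
  by exists n0.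
by apply: ge_ereal_sup => _ [n /= n0n <-]; apply: ux.
Qed.

Lemma Eexp_ge (R : realType) (A : eqType) (u v : seq A) p :
  v != [::] -> u = vpow v p -> (p%:R / (size v)%:R : R)%:E <= Eexp R u.
Proof. by move=> v0 uE; apply: ereal_sup_ubound; exists (p, v). Qed.

(** A nonempty factor is its own first power. Nonnegativity makes [floor (ACE w) + 1] a positive
    natural number. *)
Lemma ACE_ge0 (R : realType) (A : eqType) (w : nat -> A) : 0 <= ACE R w.
Proof.
apply: limf_esup_ge0 => // n.
apply: (@le_trans _ _ (Eexp R (seg w 0 n))); last first.
  by apply: ereal_sup_ubound; exists (seg w 0 n) => //; exact: Fact_seg.
have [v v0 ->] : exists2 v, v != [::] & seg w 0 n = vpow v n.
  case: n => [|n]; first by exists [:: w 0%N].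
  exists (seg w 0 n.+1) => //.
  by rewrite [RHS](@take_size_cat _ n.+1 (seg w 0 n.+1)) ?size_seg.
by apply: le_trans (Eexp_ge R v0 erefl); rewrite lee_fin divr_ge0.
Qed.

Theorem theorem22 (R : realType) (Sigma Gamma : finType)
  (hS : (2 <= #|Sigma|)%N) (hG : (2 <= #|Gamma|)%N) (w : nat -> Sigma) :
  ACE_I R Gamma w <=
  (match ACE R w with
   | r%:E => ((#|Sigma|.+1)%:R
              + (#|Sigma| * #|Sigma|.+1)%:R * ((Num.floor r)%:~R + 1) : R)%:E
   | _ => +oo
   end).
Proof.
case ACEr : (ACE R w) => [r| |]; rewrite ?leey //.
have r0 : (0 <= r)%R by rewrite -lee_fin -ACEr ACE_ge0.
have [e e0 eE] : exists2 e : nat, (0 < e)%N &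
    ((Num.floor r)%:~R + 1 = e%:R :> R)%R.
  exists `|Num.floor r|.+1 => //.
  by rewrite -natr1 natr_absz ger0_norm // floor_ge0.
have re : (r%:E < (e%:R : R)%:E) by rewrite lte_fin -eE -intrD1 floorD1_gt.
have [n0 wn0] : exists n0, forall n, (n0 <= n)%N ->
    ereal_sup [set Eexp R u | u in Fact w n] < (e%:R : R)%:E.
  by apply: limn_esup_lt; rewrite -ACEr in re.
have wpow d X x : (n0 <= d)%N -> Fact w d X -> x != [::] -> X = vpow x d ->
    (d < size x * e)%N.
  move=> n0d XF x0 XE; have sx0 : (0 < size x)%N by rewrite lt0n size_eq0.
  have : (d%:R / (size x)%:R : R)%:E < e%:R%:E.
    apply: le_lt_trans (wn0 d n0d); apply: le_trans (Eexp_ge R x0 XE) _.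
    by apply: ereal_sup_ubound; exists X.
  by rewrite lte_fin ltr_pdivrMr ?ltr0n // -natrM ltr_nat mulnC.
apply: ge_ereal_sup => _ [h /= h_inj <-].
have [n1 bound] := image_power_bound h_inj e0 wpow.
apply: (@limn_esup_le _ _ _ n1) => n n1n.
apply: ge_ereal_sup => _ [u uF <-]; apply: ge_ereal_sup => _ [[p v] /= [v0 uE] <-].
have np : n = p by case: uF => <- _; rewrite uE size_vpow.
have sv0 : (0 < size v)%N by rewrite lt0n size_eq0.
rewrite -np in uE *; have := bound n u v n1n uF v0 uE.
rewrite lee_fin ler_pdivrMr ?ltr0n // eE -!natrM -natrD -natrM ler_nat.
(* Since [#|Sigma| >= 2], the constant 3 is at most [#|Sigma| + 1]. *)
move=> /leq_trans; apply; rewrite leq_mul2r; apply/orP; right.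
by rewrite addnC leq_add // -mulnA leq_mul2l leq_pmull ?orbT.
Qed.
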